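(* Let $k$ be a positive integer and let $w$ be a unitary element of $\mathcal{F}_n^k$. If $w\mathcal{D}_n^1w^*=\varphi^{k-1}(\mathcal{D}_n^1)$ then $\lambda_w(\mathcal{D}_n)\subseteq\mathcal{D}_n$.
   Context: Let $n\ge 2$ be an integer and let $\mathcal{O}_n$ be the Cuntz algebra, generated by isometries $S_1,\ldots,S_n$ with $\sum_{i=1}^n S_iS_i^*=I$. For a multi-index $\alpha=(\alpha_1,\ldots,\alpha_k)\in\{1,\ldots,n\}^k$ put $S_\alpha=S_{\alpha_1}\cdots S_{\alpha_k}$. $\mathcal{F}_n^k$ is the span of $S_\alpha S_\beta^*$ with $\alpha,\beta\in\{1,\ldots,n\}^k$ (isomorphic to $M_{n^k}(\mathbb{C})$). $\mathcal{D}_n$ is the $C^*$-subalgebra of $\mathcal{O}_n$ generated by all projections $S_\alpha S_\alpha^*$ over all multi-indices $\alpha$, and $\mathcal{D}_n^1=\mathcal{D}_n\cap\mathcal{F}_n^1=\operatorname{span}\{S_iS_i^*\}$. The canonical shift is $\varphi(x)=\sum_{i=1}^n S_ixS_i^*$, with $\varphi^0=\mathrm{id}$. For a unitary $w\in\mathcal{O}_n$, $\lambda_w$ is the unital $*$-endomorphism of $\mathcal{O}_n$ determined by $\lambda_w(S_i)=wS_i$, $i=1,\ldots,n$. *)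

(* Defs.v *)
From HB Require Import structures.
From mathcomp Require Import all_boot all_order all_algebra.
From mathcomp Require Import all_classical all_reals all_analysis.
From mathcomp Require Import complex.
Set Implicit Arguments.
Unset Strict Implicit.
Unset Printing Implicit Defensive.
Import Order.TTheory GRing.Theory Num.Theory.
Import numFieldNormedType.Exports.
Local Open Scope classical_set_scope.
Local Open Scope complex_scope.
Local Open Scope ring_scope.

(** Unital C*-algebras over the complex numbers [R[i]]; [GRing.Algebra] makes
    the multiplication bilinear over [R[i]] and imposes [1 != 0].

    The library norm on a ring lives in structures above [numDomainType], so
    that no structure can join [GRing.Algebra] with [NormedModule].  The norm is
    therefore a field of the mixin, with values in the nonnegative reals of
    [R[i]] as everywhere in MathComp-Analysis, and the topology which it induces
    is attached to every [cstarAlgType] afterwards.  For the same reason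
    completeness is written with the balls of [cnorm]: Cauchy filters converge.
*)
HB.mixin Record isCStar (R : realType) A & GRing.Algebra R[i] A := {
  cnorm : A -> R[i];
  ler_cnormD : forall x y : A, cnorm (x + y) <= cnorm x + cnorm y;
  cnormZ : forall (a : R[i]) (x : A), cnorm (a *: x) = `|a| * cnorm x;
  cnorm0_eq0 : forall x : A, cnorm x = 0 -> x = 0;
  cnorm_complete : forall F : set_system A, ProperFilter F ->
    (forall e : R[i], 0 < e -> exists x : A, F [set y | cnorm (x - y) < e]) ->
    exists l : A, forall e : R[i], 0 < e -> F [set y | cnorm (l - y) < e];
  ler_cnormM : forall x y : A, cnorm (x * y) <= cnorm x * cnorm y;
  star : A -> A;
  starK : involutive star;
  starD : {morph star : x y / x + y};
  starZ : forall (a : R[i]) (x : A), star (a *: x) = a^* *: star x;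
  starM : forall x y : A, star (x * y) = star y * star x;
  cnorm_starM : forall x : A, cnorm (star x * x) = cnorm x ^+ 2
}.

#[short(type="cstarAlgType")]
HB.structure Definition CStarAlgebra (R : realType) :=
  {A of GRing.Algebra R[i] A & isCStar R A}.

#[non_forgetful_inheritance]
HB.instance Definition _ (R : realType) (A : cstarAlgType R) :=
  @Lmodule_isNormed.Build R[i] (CStarAlgebra.sort A) (@cnorm R A)
    (@ler_cnormD R A) (@cnormZ R A) (@cnorm0_eq0 R A).

Lemma cstar_cauchy_cvg (R : realType) (A : cstarAlgType R) (F : set_system A) :
  ProperFilter F -> cauchy F -> cvg F.
Proof.
move=> FF /cauchyP Fc.
have [|l Fl] := @cnorm_complete R A F FF.
  move=> e e0; have [x] := Fc _ e0.
  by rewrite -ball_normE => Fx; exists x.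
apply/cvg_ex; exists l; apply/cvg_ballP => e e0.
by rewrite near_simpl; move: (Fl e e0); rewrite -ball_normE.
Qed.

#[non_forgetful_inheritance]
HB.instance Definition _ (R : realType) (A : cstarAlgType R) :=
  Uniform_isComplete.Build (CStarAlgebra.sort A) (@cstar_cauchy_cvg R A).

Section CStar.
Context {R : realType} {A : cstarAlgType R}.
Implicit Types (x : A) (B G : set A).

Definition isometry x := star x * x = 1.

Definition unitary x := star x * x = 1 /\ x * star x = 1.

Definition star_subalg B :=
  [/\ B 0,
      forall x y, B x -> B y -> B (x + y),
      forall (a : R[i]) x, B x -> B (a *: x),
      forall x y, B x -> B y -> B (x * y)
    & forall x, B x -> B (star x)].

Definition cstar_subalg B := star_subalg B /\ closed B.

Definition cstar_gen G : set A := smallest cstar_subalg G.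

End CStar.

Definition star_morphism {R : realType} {A B : cstarAlgType R} (f : A -> B) :=
  {morph f : x / star x}.

Definition cuntz_family {R : realType} {n : nat} {A : cstarAlgType R}
    (S : 'I_n -> A) :=
  (forall i, isometry (S i)) /\ \sum_i S i * star (S i) = 1.

(** [is_cuntz S]: the algebra [A] is the Cuntz algebra O_n, with canonical
    generators [S].  The last clause is the universal property which provides
    the endomorphisms lambda_w; by Cuntz's uniqueness theorem it follows from
    the first two when [2 <= n]. *)
Definition is_cuntz {R : realType} {n : nat} {A : cstarAlgType R}
    (S : 'I_n -> A) :=
  [/\ cuntz_family S,
      cstar_gen (range S) = setT
    & forall (B : cstarAlgType R) (T : 'I_n -> B), cuntz_family T ->
        exists f : {lrmorphism A -> B},
          star_morphism f /\ forall i, f (S i) = T i].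

Section Cuntz.
Context {R : realType} {n : nat} {A : cstarAlgType R} (S : 'I_n -> A).

Definition Smon (alpha : seq 'I_n) : A := \prod_(i <- alpha) S i.

Definition cuntzF (k : nat) : set A :=
  [set x | exists c : k.-tuple 'I_n -> k.-tuple 'I_n -> R[i],
     x = \sum_alpha \sum_beta c alpha beta *: (Smon alpha * star (Smon beta))].

Definition cuntzD : set A :=
  cstar_gen (range (fun alpha : seq 'I_n => Smon alpha * star (Smon alpha))).

Definition cuntzD1 : set A := cuntzD `&` cuntzF 1.

Definition cuntz_shift (x : A) : A := \sum_i S i * x * star (S i).

(** [is_lambda w f]: [f] is lambda_w.  Linearity, multiplicativity and [f 1 = 1]
    are carried by [{lrmorphism A -> A}]. *)
Definition is_lambda (w : A) (f : {lrmorphism A -> A}) :=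
  star_morphism f /\ forall i, f (S i) = w * S i.

Lemma is_lambda_exists (w : A) :
  is_cuntz S -> unitary w -> exists f : {lrmorphism A -> A}, is_lambda w f.
Proof.
case=> -[Siso Ssum] _ univ [w1 w2].
suff cw : cuntz_family (fun i => w * S i).
  by have [f fP] := univ A _ cw; exists f.
split=> [i|].
  by rewrite /isometry starM mulrA -(mulrA _ (star w)) w1 mulr1 Siso.
transitivity (w * 1 * star w); last by rewrite mulr1.
rewrite -Ssum mulr_sumr mulr_suml.
by apply: eq_bigr => i _; rewrite starM !mulrA.
Qed.

End Cuntz.

(* Main.v *)
(** Write P_i = S_i S_i^* and phi for the canonical shift.  The range of phi^k
    commutes with F_n^k, and lambda_w(phi(x)) = w phi(lambda_w(x)) w^*.  If
    lambda_w(phi^m(P_i)) = phi^(m+k-1)(d) with d in D_n^1, then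
    lambda_w(phi^(m+1)(P_i)) = w phi^(m+k)(d) w^* = phi^(m+k)(d); the case m = 0
    is the hypothesis on w.  Each S_a S_a^* is a product of such phi^m(P_i), so
    lambda_w maps the generators of D_n into D_n.

    Two facts on C*-algebras are proved on the way without spectral theory.

    A *-morphism f is bounded: for self-adjoint h of norm at most 3/4 there is a
    self-adjoint b commuting with h such that h^2 + b^2 = 1, hence f(h) + i f(b)
    is unitary and f(h), its real part, has norm at most 1.

    The ranges of the S_i are orthogonal: b_k = S_j^* P_k S_j satisfies
    |1 - b_k| <= 1 and the b_k with k <> j sum to 0, which forces b_k = 0 since
    1 is an extreme point of the unit ball. *)
Require Import Defs.
From mathcomp Require Import all_boot all_order all_algebra.
From mathcomp Require Import all_classical all_reals all_analysis.
From mathcomp Require Import complex lra ring.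
Set Implicit Arguments.
Unset Strict Implicit.
Unset Printing Implicit Defensive.
Import Order.TTheory GRing.Theory Num.Theory.
Import numFieldNormedType.Exports.
Local Open Scope classical_set_scope.
Local Open Scope complex_scope.
Local Open Scope ring_scope.

(** * The norm with values in the real field *)

Lemma exists_geo_lt (R : realType) (q e : R) :
  0 <= q < 1 -> 0 < e -> exists m, q ^+ m < e.
Proof.
move=> /andP[q0 q1] e0.
have /cvgrPdist_lt/(_ e e0) [m _ /(_ m (leqnn m)) /=] :
    (fun m => q ^+ m) @ \oo --> (0 : R) by apply: cvg_expr; rewrite ger0_norm.
by rewrite sub0r normrN => me; exists m; exact: le_lt_trans (ler_norm _) me.
Qed.

Section RealNorm.
Context {R : realType} {A : cstarAlgType R}.
Implicit Types (x y : A) (c : R).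

Definition rnorm x : R := complex.Re (cnorm x).

Lemma cnormE x : cnorm x = (rnorm x)%:C.
Proof. by rewrite /rnorm RRe_real // ger0_real //; exact: (normr_ge0 x). Qed.

Lemma rnorm_ge0 x : 0 <= rnorm x.
Proof. by rewrite -lecR -cnormE; exact: (normr_ge0 x). Qed.

Lemma rnormD x y : rnorm (x + y) <= rnorm x + rnorm y.
Proof. by rewrite -lecR rmorphD /= -!cnormE ler_cnormD. Qed.

Lemma rnormM x y : rnorm (x * y) <= rnorm x * rnorm y.
Proof. by rewrite -lecR rmorphM /= -!cnormE ler_cnormM. Qed.

Lemma rnormZ c x : rnorm (c%:C *: x) = `|c| * rnorm x.
Proof.
apply: (@complexI R).
by rewrite -cnormE cnormZ cnormE normc_def /= expr0n addr0 sqrtr_sqr rmorphM.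
Qed.

Lemma rnorm_eq0 x : rnorm x = 0 -> x = 0.
Proof. by move=> x0; apply: cnorm0_eq0; rewrite cnormE x0. Qed.

Lemma rnorm0 : rnorm (0 : A) = 0.
Proof. by apply: (@complexI R); rewrite -cnormE; exact: (normr0 A). Qed.

Lemma rnormN x : rnorm (- x) = rnorm x.
Proof. by apply: (@complexI R); rewrite -!cnormE; exact: (normrN x). Qed.

Lemma rnorm_distC x y : rnorm (x - y) = rnorm (y - x).
Proof. by rewrite -rnormN opprB. Qed.

Lemma rnorm_starM x : rnorm (star x * x) = rnorm x ^+ 2.
Proof. by apply: (@complexI R); rewrite -cnormE cnorm_starM cnormE rmorphXn. Qed.

(** The C*-identity gives |z|^2 <= |z^*| |z|; cancel |z|, then use this for both [x] and
    [star x]. *)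
Lemma rnorm_star x : rnorm (star x) = rnorm x.
Proof.
suff le_star z : rnorm z <= rnorm (star z).
  by apply/eqP; rewrite eq_le -{2}(starK x) !le_star.
have := rnormM (star z) z; rewrite rnorm_starM.
have [->|z0] := eqVneq (rnorm z) 0; first by rewrite rnorm_ge0.
by rewrite expr2 ler_pM2r // lt_def z0 rnorm_ge0.
Qed.

Lemma star1 : star (1 : A) = 1.
Proof. by rewrite -[LHS]mulr1 -{2}[1]starK -starM mulr1 starK. Qed.

Lemma star0 : star (0 : A) = 0.
Proof. by apply: (addrI (star 0)); rewrite -starD !addr0. Qed.

Lemma starN x : star (- x) = - star x.
Proof. by apply: (addrI (star x)); rewrite -starD !subrr star0. Qed.

Lemma star_sum (I : Type) (r : seq I) (P : pred I) (F : I -> A) :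
  star (\sum_(i <- r | P i) F i) = \sum_(i <- r | P i) star (F i).
Proof. exact: (big_morph _ (@starD _ A) star0). Qed.

Lemma starZr c x : star (c%:C *: x) = c%:C *: star x.
Proof. by rewrite starZ; congr (_ *: _); exact: conjc_real. Qed.

Lemma rnorm1 : rnorm (1 : A) = 1.
Proof.
have := rnorm_starM 1; rewrite star1 mulr1 => n1.
have n0 : rnorm (1 : A) != 0.
  by apply: contra_neq (oner_neq0 A) => /rnorm_eq0.
by apply: (mulfI n0); rewrite mulr1 -expr2 -n1.
Qed.

Lemma rnorm_isometry x : star x * x = 1 -> rnorm x = 1.
Proof.
move=> ix; have := rnorm_starM x; rewrite ix rnorm1 => /esym/eqP.
by rewrite sqrf_eq1 => /orP[/eqP//|/eqP x1]; have := rnorm_ge0 x; rewrite x1 oppr_ge0 ler10.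
Qed.

Lemma rnorm_sum (I : Type) (r : seq I) (P : pred I) (F : I -> A) :
  rnorm (\sum_(i <- r | P i) F i) <= \sum_(i <- r | P i) rnorm (F i).
Proof.
elim/big_ind2: _ => [|x a y b xa yb|//]; first by rewrite rnorm0.
by rewrite (le_trans (rnormD _ _)) // lerD.
Qed.

Lemma rnorm_le_eps x (C : R) :
  (forall e : R, 0 < e -> rnorm x <= C * e) -> x = 0.
Proof.
move=> xC; apply: rnorm_eq0; apply/eqP; rewrite eq_le rnorm_ge0 andbT.
apply/ler_addgt0Pr => e e0; rewrite add0r.
have C0 : 0 < `|C| + 1 by rewrite ltr_wpDl.
apply: le_trans (xC (e / (`|C| + 1)) _) _; first by rewrite divr_gt0.
rewrite mulrCA ger_pMr // ler_pdivrMr // mul1r.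
by rewrite (le_trans (ler_norm C)) // lerDl.
Qed.

Lemma rnorm_cvg (y : nat -> A) :
  (forall m, rnorm (y m.+1 - y m) <= 2^-1 ^+ m) ->
  exists l, forall m, rnorm (l - y m) <= 2 * 2^-1 ^+ m.
Proof.
move=> ystep.
(* Keeping the subtracted term [2^-1 ^+ (m + p)] lets the induction on [p] close. *)
have ydist m p : rnorm (y (m + p)%N - y m) <= 2 * (2^-1 ^+ m - 2^-1 ^+ (m + p)).
  elim: p => [|p IH]; first by rewrite addn0 !subrr rnorm0 mulr0.
  rewrite -(subrKA (y (m + p)%N)) (le_trans (rnormD _ _)) //.
  have := ystep (m + p)%N; rewrite addnS exprSr => H.
  have := lerD H IH; move=> /le_trans; apply; lra.
have ydist' m p : rnorm (y (m + p)%N - y m) <= 2 * 2^-1 ^+ m.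
  apply: le_trans (ydist m p) _.
  by rewrite ler_pM2l // gerBl exprn_ge0 // invr_ge0.
have [|l yl] := @cnorm_complete R A (y @ \oo) _.
  move=> e; rewrite ltcE /= => /andP[/eqP e0 epos].
  (* Being positive in [R[i]], [e] is real; halving it absorbs the factor 2 of the tail bound. *)
  have [||m me] := @exists_geo_lt R 2^-1 (complex.Re e / 2); try lra.
  exists (y m); exists m => //= p mp.
  rewrite /preimage /= cnormE ltcE /= -e0 eqxx /=.
  have := ydist' m (p - m)%N; rewrite (subnKC mp) rnorm_distC; lra.
exists l => m; apply/ler_addgt0Pr => e e0.
have [|N _ yN] := yl e%:C; first by rewrite ltcR.
have /= := yN (N + m)%N (leq_addr _ _); rewrite cnormE ltcR => H.
rewrite -(subrKA (y (N + m)%N)) (le_trans (rnormD _ _)) // addrC.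
by rewrite lerD ?(ltW H) // addnC.
Qed.

End RealNorm.

Lemma closed_preimage_lipschitz {R : realType} {A B : cstarAlgType R}
    (f : A -> B) (C : R) (D : set B) :
  (forall x y, rnorm (f x - f y) <= C * rnorm (x - y)) ->
  closed D -> closed (f @^-1` D).
Proof.
move=> fC; apply: (continuous_closedP f).1 => x.
apply/(@cvgrPdist_lt R[i] B A (nbhs x) (nbhs_filter x)) => e.
rewrite ltcE /= => /andP[/eqP eI e0].
have C0 : 0 < `|C| + 1 by rewrite ltr_wpDl.
have d0 : 0 < (complex.Re e / (`|C| + 1))%:C by rewrite ltcR divr_gt0.
apply: filterS (nbhsx_ballx x _ d0) => y.
rewrite -ball_normE /ball_ /= [`|x - y|](cnormE (x - y)) ltcR.
rewrite ltr_pdivlMr // mulrC => xy.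
rewrite [`|_|](cnormE (f x - f y)) ltcE /= -eI eqxx /=.
apply: le_lt_trans (fC x y) _; apply: le_lt_trans xy.
by rewrite ler_wpM2r ?rnorm_ge0 // (le_trans (ler_norm C)) // lerDl.
Qed.

(** * The unit is an extreme point of the unit ball *)

Section Vertex.
Context {R : realType} {A : cstarAlgType R}.
Implicit Types (x y : A).

Local Notation ii := ('i%C : R[i]).

Lemma sqr_ii : ii * ii = -1.
Proof. by apply/eqP; rewrite eq_complex /=; apply/andP; split; apply/eqP; ring. Qed.

Lemma starZi x : star (ii *: x) = - (ii *: star x).
Proof.
rewrite starZ -scaleNr; congr (_ *: _).
by apply/eqP; rewrite eq_complex /= oppr0 !eqxx.
Qed.

Lemma rnorm_half x y : rnorm x <= 1 -> rnorm y <= 1 ->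
  rnorm ((2^-1 : R)%:C *: (x + y)) <= 1.
Proof.
move=> x1 y1; rewrite rnormZ ger0_norm ?invr_ge0 //.
have := rnormD x y; lra.
Qed.

(** Encoding polynomials in [x] by their coefficients turns identities in the algebra into scalar
    ones, within reach of [ring] and [field]. *)
Definition cubic x (a b c d : R[i]) : A :=
  a *: 1 + b *: x + c *: (x ^+ 2) + d *: (x ^+ 3).

Lemma cubicD x a b c d a' b' c' d' :
  cubic x a b c d + cubic x a' b' c' d' =
  cubic x (a + a') (b + b') (c + c') (d + d').
Proof.
rewrite /cubic !scalerDl.
by rewrite (addrACA _ (d *: _)) (addrACA _ (c *: _)) (addrACA _ (b *: _)).
Qed.

Lemma cubicZ x w a b c d :
  w *: cubic x a b c d = cubic x (w * a) (w * b) (w * c) (w * d).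
Proof. by rewrite /cubic !scalerDr !scalerA. Qed.

Lemma cubicM x z a b c :
  (1 + z *: x) * cubic x a b c 0 = cubic x a (b + z * a) (c + z * b) (z * c).
Proof.
rewrite mulrDl mul1r (_ : z *: x * _ = cubic x 0 (z * a) (z * b) (z * c)).
  by rewrite cubicD addr0 add0r.
rewrite /cubic !scale0r !addr0 add0r -scalerAl !mulrDr -!scalerAr mulr1.
by rewrite -!exprS -!expr2 !scalerDr !scalerA.
Qed.

Lemma cubic_expr x z :
  (1 + z *: x) ^+ 3 = cubic x 1 (3 * z) (3 * (z * z)) (z * z * z).
Proof.
have -> : (1 + z *: x) ^+ 3 = (1 + z *: x) * ((1 + z *: x) *
    ((1 + z *: x) * cubic x 1 0 0 0)).
  by rewrite /cubic !scale0r !addr0 scale1r mulr1.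
rewrite cubicM !mulr0 !addr0 cubicM !mulr0 cubicM.
by congr (cubic _ _ _ _ _); ring.
Qed.

(** Contractivity of 1 + z x at the four fourth roots of unity z. Unlike its first two clauses
    alone, the condition is stable under multiplication of [x] by i, so that it can be iterated. *)
Definition four_vertex x : Prop :=
  [/\ rnorm (1 + x) <= 1, rnorm (1 - x) <= 1,
      rnorm (1 + ii *: x) <= 1 & rnorm (1 - ii *: x) <= 1].

Lemma four_vertexZi x : four_vertex x -> four_vertex (ii *: x).
Proof.
by case=> h1 h2 h3 h4; split; rewrite // scalerA sqr_ii scaleN1r ?opprK.
Qed.

Lemma rnorm_exp_le1 x m : rnorm x <= 1 -> rnorm (x ^+ m) <= 1.
Proof.
move=> x1; elim: m => [|m IH]; first by rewrite expr0 rnorm1.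
rewrite exprS (le_trans (rnormM _ _)) //.
by rewrite -[leRHS]mulr1 ler_pM ?rnorm_ge0.
Qed.

(* 1 + (3/2) x is a convex combination of cubes of contractions: the weights
   below kill the coefficients of x^2 and x^3. *)
Lemma four_vertex_gain x :
  four_vertex x -> rnorm (1 + (3 / 2 : R)%:C *: x) <= 1.
Proof.
case=> h1 h2 h3 h4.
have h5 := rnorm_half h1 h3; have h6 := rnorm_half h1 h4.
have -> : 1 + (3 / 2 : R)%:C *: x =
  (6^-1 : R)%:C *: (1 + x) ^+ 3 +
  (12^-1 : R)%:C *: (1 + ii *: x) ^+ 3 +
  (12^-1 : R)%:C *: (1 - ii *: x) ^+ 3 +
  (3^-1 : R)%:C *: ((2^-1 : R)%:C *: (1 + x + (1 + ii *: x))) ^+ 3 +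
  (3^-1 : R)%:C *: ((2^-1 : R)%:C *: (1 + x + (1 - ii *: x))) ^+ 3.
  have half z : (2^-1 : R)%:C *: (1 + x + (1 + z *: x)) =
      1 + (2^-1 : R)%:C * (1 + z) *: x.
    rewrite addrACA scalerDr -{1}(scale1r x) -scalerDl scalerA; congr (_ + _).
    rewrite -{1 2}(scale1r (1 : A)) -scalerDl scalerA -[RHS]scale1r; congr (_ *: _).
    by apply/eqP; rewrite eq_complex /=; apply/andP; split; apply/eqP; field.
  rewrite -!scaleNr !half -{2}(scale1r x) !cubic_expr !cubicZ !cubicD.
  have -> : 1 + (3 / 2 : R)%:C *: x = cubic x 1 (3 / 2 : R)%:C 0 0.
    by rewrite /cubic !scale0r !addr0 scale1r.
  by congr (cubic _ _ _ _ _); apply/eqP; rewrite eq_complex /=;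
    apply/andP; split; apply/eqP; field.
have cvx (t : R) y : 0 <= t -> rnorm y <= 1 -> rnorm (t%:C *: y ^+ 3) <= t.
  move=> t0 y1; rewrite rnormZ ger0_norm // -[leRHS]mulr1 ler_wpM2l //.
  exact: rnorm_exp_le1.
apply: (@le_trans _ _ (6^-1 + 12^-1 + 12^-1 + 3^-1 + 3^-1)); last lra.
by do 4![apply: le_trans (rnormD _ _) _; apply: lerD; last by apply: cvx];
  apply: cvx.
Qed.

(** [four_vertex_gain] applies to each of x, ix, -x and -ix. *)
Lemma four_vertexZ x : four_vertex x -> four_vertex ((3 / 2 : R)%:C *: x).
Proof.
move=> x1; have x2 := four_vertexZi x1; have x3 := four_vertexZi x2.
have x4 := four_vertexZi x3.
have iiZ z : ii *: ((3 / 2 : R)%:C *: z) = (3 / 2 : R)%:C *: (ii *: z).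
  by rewrite !scalerA mulrC.
move: x1 x2 x3 x4 => /four_vertex_gain g1 /four_vertex_gain g2.
move=> /four_vertex_gain g3 /four_vertex_gain g4.
move: g3 g4; rewrite (_ : ii *: (ii *: x) = - x); last first.
  by rewrite scalerA sqr_ii scaleN1r.
rewrite !scalerN => g3 g4; by split; rewrite // iiZ.
Qed.

(** Iterating the gain, t = (3/2)^m keeps 1 + t x and 1 - t x in the unit ball. Half their
    difference is t x, so |x| <= (2/3)^m for every m. *)
Lemma four_vertex_eq0 x : four_vertex x -> x = 0.
Proof.
move=> x1; apply: (@rnorm_le_eps _ _ x 1) => e e0; rewrite mul1r.
have [||m me] := @exists_geo_lt R (2 / 3) e; try lra.
have [h1 h2 _ _] : four_vertex (((3 / 2 : R) ^+ m)%:C *: x).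
  elim: m {me} => [|m IH]; first by rewrite expr0 scale1r.
  by rewrite exprS rmorphM -scalerA; exact: four_vertexZ.
apply/ltW; apply: le_lt_trans me.
have p1 : (3 / 2 : R) ^+ m * (2 / 3) ^+ m = 1.
  by rewrite -exprMn (_ : 3 / 2 * (2 / 3) = 1) ?expr1n //; field.
have t0 : 0 < (3 / 2 : R) ^+ m by rewrite exprn_gt0 //; lra.
rewrite -(ler_pM2l t0) p1; move: h1 h2; rewrite -(rnormN (1 - _)) => h1 h2.
have := rnorm_half h1 h2; rewrite opprB addrC subrKA -scalerDl.
rewrite scalerA -rmorphD -rmorphM rnormZ ger0_norm.
  by move: (_ ^+ m) => t; rewrite (_ : 2^-1 * (t + t) = t) //; field.
by rewrite mulr_ge0 ?invr_ge0 // addr_ge0 // ltW.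
Qed.

(* The C*-identity gives the missing bounds: |1 - ix|^2 = |1 + x^2|, and 1 + x^2
   is the mean of (1 + x)^2 and (1 - x)^2. *)
Lemma selfadjoint_vertex_eq0 x : star x = x ->
  rnorm (1 + x) <= 1 -> rnorm (1 - x) <= 1 -> x = 0.
Proof.
move=> sx h1 h2; apply: four_vertex_eq0.
suff h3 : rnorm (1 - ii *: x) <= 1.
  split=> //; have := rnorm_star (1 - ii *: x).
  by rewrite starD starN star1 starZi sx opprK => ->.
rewrite -(ler_pXn2r (n := 2)) ?nnegrE ?rnorm_ge0 // expr1n -rnorm_starM.
rewrite starD starN star1 starZi sx opprK.
have -> : (1 + ii *: x) * (1 - ii *: x) =
    (2^-1 : R)%:C *: ((1 + x) * (1 + x) + (1 - x) * (1 - x)).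
  have expand (u v : A) : (1 + u) * (1 + v) = 1 + u * v + (u + v).
    by rewrite mulrDl !mulrDr !mul1r mulr1 (addrC u (u * v)) addrACA (addrC v).
  have iixx : ii *: x * (ii *: x) = - (x * x).
    by rewrite -scalerAl -scalerAr; rewrite scalerA sqr_ii scaleN1r.
  rewrite !expand subrr addr0 mulrNN mulrN iixx.
  rewrite opprK addrACA -opprD subrr addr0 -mulr2n.
  rewrite -(scaler_nat 2 (_ + _)) scalerA.
  rewrite -[LHS]scale1r; congr (_ *: _).
  by rewrite -(rmorph_nat (real_complex R)) -rmorphM mulVf.
by apply: rnorm_half; rewrite -expr2 rnorm_exp_le1.
Qed.

(** Let c be the cardinality of [P]. Both c + b_i, which is 1 plus the sum of the 1 - b_j for j <>
    i, and c - b_i = (c - 1) + (1 - b_i) have norm at most c. Hence [selfadjoint_vertex_eq0] applies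
    to b_i / c. *)
Lemma selfadjoint_sum0 (I : finType) (P : pred I) (b : I -> A) :
  (forall i, star (b i) = b i) -> (forall i, rnorm (1 - b i) <= 1) ->
  \sum_(i | P i) b i = 0 -> forall i, P i -> b i = 0.
Proof.
move=> sb b1 sum0 i Pi; pose c : R := #|P|%:R.
have cE : c = 1 + \sum_(j | P j && (j != i)) 1.
  by rewrite /c -sum1_card natr_sum (bigD1 i).
have c0 : 0 < c by rewrite cE ltr_pwDl // sumr_ge0.
have csum : c%:C *: 1 + b i = 1 + \sum_(j | P j && (j != i)) (1 - b j).
  move: sum0; rewrite (bigD1 i) //= => /eqP; rewrite addr_eq0 => /eqP ->.
  rewrite cE rmorphD /= scalerDl scale1r -addrA sumrB; congr (_ + (_ - _)).
  by rewrite rmorph_sum scaler_suml; apply: eq_bigr => j _; rewrite scale1r.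
have le1 : rnorm (c%:C *: 1 + b i) <= c.
  rewrite csum (le_trans (rnormD _ _)) // rnorm1 cE lerD2l.
  by rewrite (le_trans (rnorm_sum _ _ _)) // ler_sum.
have le2 : rnorm (c%:C *: 1 - b i) <= c.
  rewrite (_ : c%:C *: 1 - b i = (c - 1)%:C *: 1 + (1 - b i)); last first.
    by rewrite addrA rmorphB scalerBl scale1r subrK.
  rewrite (le_trans (rnormD _ _)) // rnormZ rnorm1 mulr1 ger0_norm.
    by rewrite -lerBrDl opprB addrCA subrr addr0.
  by rewrite cE addrAC subrr add0r sumr_ge0.
have cc : c^-1%:C * c%:C = 1 :> R[i] by rewrite -rmorphM mulVf ?gt_eqF.
have scale_le1 y : rnorm y <= c -> rnorm (c^-1%:C *: y) <= 1.
  move=> yc; rewrite rnormZ gtr0_norm ?invr_gt0 //.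
  by rewrite ler_pdivrMl // mulr1.
suff : c^-1%:C *: b i = 0.
  move=> /(congr1 (fun y => c%:C *: y)).
  by rewrite scalerA mulrC cc scale1r scaler0.
apply: selfadjoint_vertex_eq0; first by rewrite starZr sb.
- by have := scale_le1 _ le1; rewrite scalerDr scalerA cc scale1r.
- by have := scale_le1 _ le2; rewrite scalerBr scalerA cc scale1r.
Qed.
End Vertex.

(** * Boundedness of *-morphisms *)

Lemma subr_sqr_telescope (T : nzRingType) (u v : T) :
  u * u - v * v = u * (u - v) + (u - v) * v.
Proof. by rewrite mulrBr mulrBl subrKA. Qed.

(* y = 1 - sqrt(1 - c), the fixed point of the contraction y |-> (c + y^2) / 2 of
   the ball of radius 1/2. *)
Lemma exists_quadratic_root {R : realType} {A : cstarAlgType R} (c : A) :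
  rnorm c <= 3 / 4 ->
  exists y, [/\ y + y = c + y * y, star c = c -> star y = y
    & forall z, z * c = c * z -> z * y = y * z].
Proof.
move=> c1; pose F (y : A) := (2^-1 : R)%:C *: (c + y * y).
pose y m := iter m F 0.
have half_dbl (z : A) : (2^-1 : R)%:C *: z + (2^-1 : R)%:C *: z = z.
  by rewrite -scalerDl -rmorphD -[RHS]scale1r; congr (_%:C *: _); field.
(* The bound 3/4 on [c] makes this ball stable: (3/4 + 1/4) / 2 = 1/2. *)
have y_le m : rnorm (y m) <= 2^-1.
  elim: m => [|m IH]; first by rewrite rnorm0 invr_ge0.
  rewrite /= rnormZ ger0_norm ?invr_ge0 //.
  have := rnormD c (y m * y m); have := rnormM (y m) (y m).
  have := rnorm_ge0 (y m); rewrite -/(y m); nra.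
(* On that ball |u^2 - v^2| <= |u - v|, so [F] is 1/2-Lipschitz. *)
have [|l yl] := @rnorm_cvg _ _ y.
  elim=> [|m IH]; first by rewrite subr0 expr0; apply: le_trans (y_le 1) _; lra.
  rewrite [y m.+2]/(F (y m.+1)) [in X in _ - X]/y /= -/(y m).
  rewrite /F -scalerBr opprD addrACA subrr add0r subr_sqr_telescope.
  rewrite rnormZ ger0_norm ?invr_ge0 // exprS ler_pM2l ?invr_gt0 //.
  apply: le_trans IH; apply: le_trans (rnormD _ _) _.
  have := rnormM (y m.+1) (y m.+1 - y m); have := rnormM (y m.+1 - y m) (y m).
  have := y_le m; have := y_le m.+1; have := rnorm_ge0 (y m.+1 - y m).
  have := rnorm_ge0 (y m.+1); have := rnorm_ge0 (y m); nra.
have lim0 (z : A) (C : R) :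
    0 <= C -> (forall m, rnorm z <= C * 2^-1 ^+ m) -> z = 0.
  move=> C0 zC; apply: (@rnorm_le_eps _ _ z C) => e e0.
  have [||m me] := @exists_geo_lt R 2^-1 e; try lra.
  by apply: le_trans (zC m) _; rewrite ler_wpM2l // ltW.
have l_le : rnorm l <= 2 by have := yl 0; rewrite subr0 expr0 mulr1.
exists l; split.
- apply/eqP; rewrite -subr_eq0; apply/eqP.
  (* With t = 2^-m: the two copies of l - y_(m+1) cost 2t, and y_m^2 - l^2 costs (1/2 + 2) 2t =
     5t. *)
  apply: (lim0 _ 7) => // m.
  have -> : l + l - (c + l * l) =
      (l - y m.+1) + (l - y m.+1) + (y m * y m - l * l).
    rewrite [y m.+1]/(F (y m)) /F (addrACA l) -opprD half_dbl.
    by rewrite !opprD -[RHS]addrA subrKA.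
  rewrite subr_sqr_telescope; apply: le_trans (rnormD _ _) _.
  have := rnormD (l - y m.+1) (l - y m.+1).
  have := rnormD (y m * (y m - l)) ((y m - l) * l).
  have := rnormM (y m) (y m - l); have := rnormM (y m - l) l.
  have := yl m.+1; have := yl m; rewrite (rnorm_distC l (y m)) exprS.
  have := y_le m; have := rnorm_ge0 (y m - l).
  move: (2^-1 ^+ m) => t; nra.
- move=> sc; apply/eqP; rewrite -subr_eq0; apply/eqP.
  have sy m : star (y m) = y m.
    by elim: m => [|m IH]; rewrite ?star0 //= starZr starD starM sc IH.
  apply: (lim0 _ 4) => // m; rewrite -(subrKA (y m)) -{1}(sy m).
  rewrite -[star l - _]/(star l - star (y m)) -starN -starD.
  apply: le_trans (rnormD _ _) _.
  by rewrite rnorm_star (rnorm_distC (y m)); have := yl m; lra.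
- move=> z zc; apply/eqP; rewrite -subr_eq0; apply/eqP.
  have zy m : z * y m = y m * z.
    elim: m => [|m IH]; first by rewrite mulr0 mul0r.
    by rewrite /= -scalerAr -scalerAl mulrDr mulrDl zc mulrA IH -mulrA IH mulrA.
  apply: (lim0 _ (4 * rnorm z)) => [|m]; first by rewrite mulr_ge0 ?rnorm_ge0.
  rewrite -(subrKA (z * y m)) -mulrBr zy -mulrBl.
  apply: le_trans (rnormD _ _) _.
  have := rnormM z (l - y m); have := rnormM (y m - l) z.
  rewrite (rnorm_distC (y m) l).
  have := yl m; have := rnorm_ge0 z; nra.
Qed.

Section Bounded.
Context {R : realType} {A B : cstarAlgType R} (f : {lrmorphism A -> B}).
Hypothesis fstar : star_morphism f.

Lemma star_morphism_selfadjoint_le1 (h : A) :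
  star h = h -> rnorm h <= 3 / 4 -> rnorm (f h) <= 1.
Proof.
move=> sh h1.
(* The norm of h^2 is at most 9/16 < 3/4. The root gives (1 - y)^2 = 1 - h^2, so b = 1 - y plays the
   part of the square root of 1 - h^2. *)
have [|y [yE sy cy]] := @exists_quadratic_root _ _ (h * h).
  by have := rnormM h h; have := rnorm_ge0 h; nra.
have {}sy : star y = y by apply: sy; rewrite starM sh.
have {}cy : h * y = y * h by apply: cy; rewrite mulrA.
pose b := 1 - y.
have sb : star b = b by rewrite starD starN star1 sy.
have hb : h * b = b * h by rewrite mulrBr mulrBl cy mulr1 mul1r.
have hhbb : h * h + b * b = 1.
  rewrite /b mulrBr mulr1 mulrBl mul1r opprB addrACA -opprD yE opprD.
  rewrite addrACA subrr addr0.
  by rewrite addrCA subrr addr0.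
pose u := f h + 'i%C *: f b.
have su : star u = f h - 'i%C *: f b.
  by rewrite starD starZi -!fstar sh sb.
(* In [star u * u] the cross terms cancel because [h] and [b] commute. *)
have u1 : rnorm u = 1.
  apply: rnorm_isometry; rewrite su /u mulrBl !mulrDr.
  rewrite -!scalerAl -!scalerAr scalerA sqr_ii scaleN1r.
  rewrite -!rmorphM hb opprD opprK addrA addrK -rmorphD hhbb rmorph1 //.
have -> : f h = (2^-1 : R)%:C *: (u + star u).
  rewrite su /u addrACA subrr addr0 -mulr2n -(scaler_nat 2 (f h)) scalerA.
  rewrite -[LHS]scale1r; congr (_ *: _).
  by rewrite -(rmorph_nat (real_complex R)) -rmorphM mulVf.
by apply: rnorm_half; rewrite ?rnorm_star u1.
Qed.

(** A self-adjoint element is rescaled to norm 1/2, inside the range of the previous bound. In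
    general |f(x)|^2 = |f(x^* x)| <= 2 |x|^2 by the C*-identity. *)
Lemma star_morphism_bounded (x : A) : rnorm (f x) <= 2 * rnorm x.
Proof.
have sa h : star h = h -> rnorm (f h) <= 2 * rnorm h.
  move=> sh; have [h0|h0] := eqVneq (rnorm h) 0.
    by rewrite (rnorm_eq0 h0) raddf0 !rnorm0 mulr0.
  have hgt0 : 0 < 2 * rnorm h by rewrite mulr_gt0 // lt_def h0 rnorm_ge0.
  pose t := (2 * rnorm h)^-1.
  have t0 : 0 < t by rewrite invr_gt0.
  have : rnorm (f (t%:C *: h)) <= 1.
    apply: star_morphism_selfadjoint_le1; first by rewrite starZr sh.
    rewrite rnormZ gtr0_norm // /t invfM -mulrA mulVf // mulr1; lra.
  by rewrite linearZ /= rnormZ gtr0_norm // /t ler_pdivrMl // mulr1.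
rewrite -(ler_pXn2r (n := 2)) ?nnegrE ?rnorm_ge0 ?mulr_ge0 ?rnorm_ge0 //.
rewrite -rnorm_starM -fstar -rmorphM /=.
apply: le_trans (sa _ _) _; first by rewrite starM starK.
rewrite rnorm_starM; have := rnorm_ge0 x; nra.
Qed.

End Bounded.

(** * Generated C*-subalgebras and the canonical shift *)

Section Generated.
Context {R : realType} {A B : cstarAlgType R}.
Implicit Types (G : set A) (D : set B).

Lemma cstar_gen_subalg G : cstar_subalg (cstar_gen G).
Proof.
split.
  split=> [M [[[]]]//|x y Gx Gy M|a x Gx M|x y Gx Gy M|x Gx M] MG;
    have := MG; move=> -[[[M0 MD MZ MM MS] _] _].
  - by apply: MD; [exact: Gx | exact: Gy].
  - by apply: MZ; exact: Gx.
  - by apply: MM; [exact: Gx | exact: Gy].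
  - by apply: MS; exact: Gx.
by apply: closed_bigI => M [[_ clM] _].
Qed.

Lemma subalg_sum D (I : Type) (r : seq I) (F : I -> B) :
  cstar_subalg D -> (forall i, D (F i)) -> D (\sum_(i <- r) F i).
Proof.
by move=> [[D0 DD _ _ _] _] DF; elim/big_ind: _ => [//|x y|i _]; auto.
Qed.

(** The preimage of [D] is a C*-subalgebra containing [G], closed by the Lipschitz bound. Taking [f]
    as a bare function covers the shift as well as lambda_w. *)
Lemma cstar_gen_map (f : A -> B) (C : R) G D :
  {morph f : x y / x + y} -> {morph f : x y / x * y} ->
  (forall a x, f (a *: x) = a *: f x) -> star_morphism f ->
  (forall x y, rnorm (f x - f y) <= C * rnorm (x - y)) ->
  cstar_subalg D -> (forall x, G x -> D (f x)) ->
  forall x, cstar_gen G x -> D (f x).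
Proof.
move=> fD fM fZ fS fC [[D0 DD DZ DM DS] clD] GD.
apply: (@smallest_sub _ _ _ (f @^-1` D)) => //; split.
  split=> [|x y Dx Dy|a x Dx|x y Dx Dy|x Dx] /=.
  - by rewrite /preimage /= -(scale0r 0) fZ scale0r.
  - by rewrite /preimage /= fD; exact: DD.
  - by rewrite /preimage /= fZ; exact: DZ.
  - by rewrite /preimage /= fM; exact: DM.
  - by rewrite /preimage /= fS; exact: DS.
exact: closed_preimage_lipschitz fC clD.
Qed.

End Generated.

(** * Orthogonality of the ranges, the shift and the diagonal *)

Section Cuntz.
Context {R : realType} {n : nat} {A : cstarAlgType R} (S : 'I_n -> A).
Hypothesis Scuntz : cuntz_family S.
Implicit Types (x y w : A) (i j : 'I_n) (a : seq 'I_n).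

Local Notation phi := (cuntz_shift S).

Lemma cuntz_iso i : star (S i) * S i = 1. Proof. exact: (Scuntz.1 i). Qed.

Lemma cuntz_sum : \sum_i S i * star (S i) = 1. Proof. exact: Scuntz.2. Qed.

Lemma rnorm_gen i : rnorm (S i) = 1.
Proof. exact: rnorm_isometry (cuntz_iso i). Qed.

(** This is a self-adjoint idempotent, so the C*-identity reads |q| = |q|^2. *)
Lemma rnorm_compl_range_proj i : rnorm (1 - S i * star (S i)) <= 1.
Proof.
set q := 1 - _; have sq : star q = q by rewrite starD starN star1 starM starK.
have qq : q * q = q.
  rewrite {2}/q mulrBr mulr1 {2}/q mulrBl mul1r mulrA -(mulrA (S i)) cuntz_iso.
  by rewrite mulr1 subrr subr0.
have := rnorm_starM q; rewrite sq qq; have := rnorm_ge0 q; nra.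
Qed.

Lemma cuntz_orthogonal i j : i != j -> star (S i) * S j = 0.
Proof.
move=> ij; pose b i := star (S j) * (S i * star (S i)) * S j.
(* [b i] is z^* z for z = S_i^* S_j, so it vanishes only if z does. *)
suff /(congr1 (@rnorm R A)) : b i = 0.
  rewrite (_ : b i = star (star (S i) * S j) * (star (S i) * S j)).
    by rewrite rnorm_starM rnorm0 => /eqP; rewrite sqrf_eq0 => /eqP/rnorm_eq0.
  by rewrite /b starM starK !mulrA.
apply: (@selfadjoint_sum0 _ _ _ (fun i => i != j) b) => // [k|k|].
- by rewrite /b !starM !starK !mulrA.
- have -> : 1 - b k = star (S j) * (1 - S k * star (S k)) * S j.
    by rewrite mulrBr mulrBl mulr1 cuntz_iso.
  apply: le_trans (rnormM _ _) _; rewrite rnorm_gen mulr1.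
  apply: le_trans (rnormM _ _) _; rewrite rnorm_star rnorm_gen mul1r.
  exact: rnorm_compl_range_proj.
(* The term k = j is already 1, so the others sum to 0. *)
- have : \sum_k b k = 1.
    by rewrite -mulr_suml -mulr_sumr cuntz_sum mulr1 cuntz_iso.
  rewrite (bigD1 j) //= {1}/b mulrA cuntz_iso mul1r cuntz_iso.
  by move/(canRL (addKr _)); rewrite addNr.
Qed.

(** Orthogonality leaves only the i-th term. This intertwining makes the shift multiplicative and
    gives its commutation with F_n^k. *)
Lemma shift_gen x i : phi x * S i = S i * x.
Proof.
rewrite /cuntz_shift mulr_suml (bigD1 i) //= -mulrA cuntz_iso mulr1 big1 ?addr0 //.
by move=> j ji; rewrite -mulrA cuntz_orthogonal // mulr0.
Qed.

Lemma shiftD : {morph phi : x y / x + y}.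
Proof.
move=> x y; rewrite -big_split; apply: eq_bigr => i _.
by rewrite mulrDr mulrDl.
Qed.

Lemma shiftZ (c : R[i]) x : phi (c *: x) = c *: phi x.
Proof.
by rewrite scaler_sumr; apply: eq_bigr => i _; rewrite -scalerAr -scalerAl.
Qed.

Lemma shiftM : {morph phi : x y / x * y}.
Proof.
move=> x y; rewrite [phi y]/cuntz_shift mulr_sumr; apply: eq_bigr => i _.
by rewrite !mulrA shift_gen.
Qed.

Lemma shift_star : star_morphism phi.
Proof.
move=> x; rewrite star_sum; apply: eq_bigr => i _.
by rewrite !starM starK mulrA.
Qed.

Lemma shift_lipschitz x y : rnorm (phi x - phi y) <= n%:R * rnorm (x - y).
Proof.
rewrite -sumrB (le_trans (rnorm_sum _ _ _)) //.
rewrite -[n in n%:R]card_ord mulr_natl -sumr_const ler_sum // => i _.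
rewrite -mulrBl -mulrBr (le_trans (rnormM _ _)) //.
by rewrite rnorm_star rnorm_gen mulr1 (le_trans (rnormM _ _)) // rnorm_gen mul1r.
Qed.

Lemma iter_shift_star m x : star (iter m phi x) = iter m phi (star x).
Proof. by elim: m => //= m IH; rewrite -shift_star IH. Qed.

Lemma Smon_cons i a : Smon S (i :: a) = S i * Smon S a.
Proof. exact: big_cons. Qed.

Lemma Smon_rcons i a : Smon S (rcons a i) = Smon S a * S i.
Proof. by rewrite /Smon -cats1 big_cat big_seq1. Qed.

Lemma iter_shift_Smon x a : iter (size a) phi x * Smon S a = Smon S a * x.
Proof.
elim: a => [|i a IH]; first by rewrite /Smon big_nil mul1r mulr1.
by rewrite Smon_cons /= mulrA shift_gen -!mulrA IH.
Qed.

Lemma star_Smon_iter_shift x a :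
  star (Smon S a) * iter (size a) phi x = x * star (Smon S a).
Proof.
by rewrite -[iter _ _ _]starK -starM iter_shift_star iter_shift_Smon starM starK.
Qed.

(** For words a, b of length k, both products with S_a S_b^* equal S_a x S_b^*. *)
Lemma cuntzF_commute k w x :
  cuntzF S k w -> w * iter k phi x = iter k phi x * w.
Proof.
move=> [c ->]; rewrite mulr_suml mulr_sumr; apply: eq_bigr => a _.
rewrite mulr_suml mulr_sumr; apply: eq_bigr => b _.
rewrite -scalerAl -scalerAr; congr (_ *: _).
have := star_Smon_iter_shift x b; have := iter_shift_Smon x a.
rewrite !size_tuple => xa xb.
by rewrite mulrA xa -!mulrA xb.
Qed.

Lemma cuntzD_Smon a : cuntzD S (Smon S a * star (Smon S a)).
Proof. by apply: (@sub_gen_smallest _ _ (range _)); exists a. Qed.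

(** The shift sends the generator of the word a to the sum over i of those of the words ia. *)
Lemma cuntzD_shift x : cuntzD S x -> cuntzD S (phi x).
Proof.
apply: (cstar_gen_map shiftD shiftM shiftZ shift_star shift_lipschitz).
  exact: cstar_gen_subalg.
move=> _ [a _ <-]; apply: (@subalg_sum _ _ (cuntzD S)); first exact: cstar_gen_subalg.
move=> i; rewrite -mulrA -mulrA -starM mulrA -Smon_cons; exact: cuntzD_Smon.
Qed.

Lemma cuntzD1_proj i : cuntzD1 S (S i * star (S i)).
Proof.
have [t Si] : exists t : 1.-tuple 'I_n, Smon S t = S i.
  by exists [tuple i]; rewrite /Smon big_seq1.
split; first by have := cuntzD_Smon t; rewrite Si.
(* The matrix unit at (t, t), where [t] is the one-letter word i. *)
exists (fun a b : 1.-tuple 'I_n => ((a == t) && (b == t))%:R).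
rewrite (big_only1 t) // => [|a /negPf at0 _].
  rewrite (big_only1 t) // => [|b /negPf bt _]; last by rewrite bt andbF scale0r.
  by rewrite !eqxx scale1r Si.
by rewrite big1 // => b _; rewrite at0 scale0r.
Qed.

Lemma lambda_shift w (f : {lrmorphism A -> A}) x :
  is_lambda S w f -> f (phi x) = w * phi (f x) * star w.
Proof.
move=> [fstar fS]; rewrite /cuntz_shift raddf_sum /= mulr_sumr mulr_suml.
by apply: eq_bigr => i _; rewrite !rmorphM /= fstar fS starM !mulrA.
Qed.

End Cuntz.

(** * Invariance of the diagonal under lambda_w *)

Unset Implicit Arguments.

Theorem corollary4p2 (R : realType) (n : nat) (hn : (2 <= n)%N)
    (A : cstarAlgType R) (S : 'I_n -> A) (hS : is_cuntz S)
    (k : nat) (hk : (0 < k)%N)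
    (w : A) (hwF : cuntzF S k w) (hwU : unitary w)
    (hw : [set w * x * star w | x in cuntzD1 S]
            = iter k.-1 (cuntz_shift S) @` cuntzD1 S)
    (lambda_w : {lrmorphism A -> A}) (hlambda : is_lambda S w lambda_w) :
  lambda_w @` cuntzD S `<=` cuntzD S.
Proof.
case: hS => Sc _ _; have [fstar fS] := hlambda; have [_ ww] := hwU.
have Dalg : cstar_subalg (cuntzD S) := cstar_gen_subalg _.
have lam m i : exists2 d, cuntzD1 S d &
    lambda_w (iter m (cuntz_shift S) (S i * star (S i))) =
    iter (m + k.-1) (cuntz_shift S) d.
  elim: m => [|m [d Dd IH]].
    have : [set w * x * star w | x in cuntzD1 S] (w * (S i * star (S i)) * star w).
      by exists (S i * star (S i)) => //; exact: cuntzD1_proj.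
    rewrite hw => -[d Dd dE]; exists d => //=.
    by rewrite add0n dE rmorphM /= fstar fS starM !mulrA.
  (* The same [d] serves: as k > 0, one more shift gives phi^k(phi^m(d)), which commutes with
     [w]. *)
  exists d => //; rewrite iterS (lambda_shift _ hlambda) IH -iterS -addSn.
  rewrite addSnnS prednK // addnC iterD (cuntzF_commute Sc) //.
  by rewrite -mulrA ww mulr1.
have lamD m i : cuntzD S (lambda_w (iter m (cuntz_shift S) (S i * star (S i)))).
  have [d [Dd _] ->] := lam m i.
  by elim: (m + _)%N => //= p; exact: cuntzD_shift.
move=> _ [x Dx <-]; move: x Dx.
apply: (@cstar_gen_map _ _ _ lambda_w 2) => //.
- exact: raddfD.
- exact: rmorphM.
- by move=> a x; rewrite linearZ.
- by move=> x y; rewrite -raddfB; exact: star_morphism_bounded.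
(* Induct on the last letter: the generator of the word ai is S_a P_i S_a^* = phi^|a|(P_i) S_a
   S_a^*. The empty word gives 1. *)
- move=> _ [a _ <-]; elim/last_ind: a => [|a i IH].
  + rewrite /Smon big_nil star1 mulr1 rmorph1.
    by have := @cuntzD_Smon _ _ _ S [::]; rewrite /Smon big_nil star1 mulr1.
  + rewrite Smon_rcons starM mulrA -(mulrA (Smon S a)) -(iter_shift_Smon Sc).
    rewrite -mulrA rmorphM; case: Dalg => -[_ _ _ DM _] _.
    by apply: DM; [exact: lamD | exact: IH].
Qed.
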